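(* Let $\{X_n,n\geq1\}$ be a $\varphi$-mixing sequence of random variables with common marginal distribution function $F$, whose mixing coefficients satisfy $\varphi(n)=O(n^{-3})$. Fix $p\in(0,1)$ and let $\xi_p=F^{-1}(p)=\inf\{x:F(x)\geq p\}$. Assume that $F$ possesses a positive continuous density $f$ in a neighborhood $\mathscr{N}_p$ of $\xi_p$ such that $0<d=\sup\{f(x):x\in\mathscr{N}_p\}<\infty$. Let $C_0>0$ be a constant, let $a_n\sim C_0 n^{-1/2}(\log n)^{3/4}$ (i.e. $a_n/(C_0n^{-1/2}(\log n)^{3/4})\to1$), let $\mathscr{D}_n=[\xi_p-a_n,\xi_p+a_n]$ and $$H_{p,n}=\sup_{x\in\mathscr{D}_n}\big|(F_n(x)-F(x))-(F_n(\xi_p)-p)\big|.$$ Then with probability 1, $$H_{p,n}\leq (d+4C_3)\,n^{-3/4}\log n\quad\text{for all } n \text{ sufficiently large},$$ where $C_3=4\big[1+4\sum_{n=1}^\infty\varphi^{1/2}(n)\big]$.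
   Context: All random variables are defined on a probability space $(\Omega,\mathcal{F},P)$. $F_n(x)=\frac1n\sum_{i=1}^n I(X_i\leq x)$ is the empirical distribution function of $X_1,\dots,X_n$. For $n\leq m$ let $\mathcal{F}_n^m=\sigma(X_i,n\leq i\leq m)$. For sub-$\sigma$-algebras $\mathcal{B},\mathcal{R}$ let $\varphi(\mathcal{B},\mathcal{R})=\sup_{A\in\mathcal{B},B\in\mathcal{R},P(A)>0}|P(B\mid A)-P(B)|$, and the mixing coefficients are $\varphi(n)=\sup_{k\geq1}\varphi(\mathcal{F}_1^k,\mathcal{F}_{k+n}^\infty)$. The sequence is called $\varphi$-mixing if $\varphi(n)\downarrow0$ as $n\to\infty$. *)

(* Defs.v *)
From HB Require Import structures.
From mathcomp Require Import all_boot all_order all_algebra.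
From mathcomp Require Import all_classical all_reals all_analysis.
Set Implicit Arguments. Unset Strict Implicit. Unset Printing Implicit Defensive.
Import Order.TTheory GRing.Theory Num.Theory.
Import numFieldNormedType.Exports.
Local Open Scope classical_set_scope.
Local Open Scope ring_scope.

Section Defs.
Context {d : measure_display} {T : measurableType d} {R : realType}.

Definition sigmaX (X : nat -> T -> R) (I : set nat) : set (set T) :=
  <<s [set A | exists i, I i /\ exists B : set R, measurable B /\ A = X i @^-1` B] >>.

Definition phi_sigma (P : probability T R) (G H : set (set T)) : R :=
  sup [set r : R | exists A B, G A /\ H B /\ (0 < P A)%E /\
        r = `| fine (P (A `&` B)) / fine (P A) - fine (P B) | ].

Definition phi_mix (P : probability T R) (X : nat -> T -> R) (n : nat) : R :=
  sup [set r : R | exists k : nat, (1 <= k)%N /\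
        r = phi_sigma P (sigmaX X [set i | (1 <= i <= k)%N])
                        (sigmaX X [set i | (k + n <= i)%N])].

Definition empF (X : nat -> T -> R) (n : nat) (w : T) (x : R) : R :=
  (n%:R)^-1 * \sum_(1 <= i < n.+1) ((X i w <= x)%R%:R).

End Defs.

(* Main.v *)
Require Import Defs.
From HB Require Import structures.
From mathcomp Require Import all_boot all_order all_algebra.
From mathcomp Require Import all_classical all_reals all_analysis.
From mathcomp Require Import measurable_realfun ring lra.
Set Implicit Arguments. Unset Strict Implicit. Unset Printing Implicit Defensive.
Import Order.TTheory GRing.Theory Num.Theory.
Import numFieldNormedType.Exports.
Local Open Scope classical_set_scope.
Local Open Scope ring_scope.

(** Fix an interval [(lo, hi]] of probability [q].  The indicators of
    [X_i \in (lo, hi]] take finitely many joint values, so the law of the first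
    [N] of them is a weight on [N.-tuple bool], and the whole deviation estimate
    lives on that finite space.  Cut the index set into blocks of length about
    [n^(1/4) / 2] and treat even and odd blocks separately: phi-mixing decouples
    the exponential moments of successive blocks up to a factor
    [1 + O(phi(m))], and the variance of a block is at most
    [m q (1 + 2 \sum phi)].  With exponential parameter [n^(-1/4)] the mixing
    errors multiply to a constant because [n m^(-4)] is bounded, and for
    [q = O(n^(-1/2) (log n)^(3/4))] the sum of centred indicators exceeds
    [16 n^(1/4) log n] with probability [O(n^(-4))].  A union bound over a grid
    of [2n + 1] points of [D_n] and the Borel-Cantelli lemma control the grid;
    monotonicity of [F_n] and [F] fills in the gaps, at the price of an increment
    of [F] between neighbours, which is at most [d a_n / n].  The constant is
    not sharp: only [4 C_3 >= 16] is used. *)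

(** * Decoupling and deviations on a finite probability space *)

Section FiniteExpectation.
Context {R : realType} {Omega : finType}.
Variable Q : Omega -> R.

Definition fexp (g : Omega -> R) : R := \sum_v Q v * g v.
Definition fprob (A : pred Omega) : R := \sum_(v | A v) Q v.

Lemma fexpD g h : fexp (fun v => g v + h v) = fexp g + fexp h.
Proof. by rewrite /fexp -big_split; apply: eq_bigr => v _; rewrite mulrDr. Qed.

Lemma fexpZ a g : fexp (fun v => a * g v) = a * fexp g.
Proof. by rewrite /fexp big_distrr; apply: eq_bigr => v _ /=; rewrite mulrCA. Qed.

Lemma fexp_sum (I : Type) (r : seq I) (h : I -> Omega -> R) :
  fexp (fun v => \sum_(i <- r) h i v) = \sum_(i <- r) fexp (h i).
Proof.
rewrite /fexp exchange_big /=; apply: eq_bigr => v _.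
by rewrite big_distrr.
Qed.

Lemma fexp_indic (A : pred Omega) : fexp (fun v => (A v)%:R) = fprob A.
Proof.
rewrite /fexp /fprob [RHS]big_mkcond /=; apply: eq_bigr => v _.
by case: (A v); rewrite ?mulr1 ?mulr0.
Qed.

Lemma eq_fexp g h : g =1 h -> fexp g = fexp h.
Proof. by move=> gh; apply: eq_bigr => v _; rewrite gh. Qed.

Hypothesis Q_ge0 : forall v, 0 <= Q v.
Hypothesis Q_sum1 : \sum_v Q v = 1.

Lemma fexp_cst a : fexp (fun=> a) = a.
Proof. by rewrite /fexp -big_distrl /= Q_sum1 mul1r. Qed.

Lemma le_fexp g h : (forall v, g v <= h v) -> fexp g <= fexp h.
Proof. by move=> gh; apply: ler_sum => v _; apply: ler_wpM2l. Qed.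

(** Sorting the outcomes by the value of [h] leaves only joint probabilities of [A] with events
    about [h], which is what mixing controls. *)
Lemma fexp_fiber (U : finType) (h : Omega -> U) (A : pred Omega) (g : U -> R) :
  \sum_(v | A v) Q v * g (h v) =
  \sum_b g b * fprob (fun v => A v && (h v == b)).
Proof.
rewrite (partition_big h xpredT) //=; apply: eq_bigr => b _.
by rewrite /fprob big_distrr /=; apply: eq_bigr => v /andP[_ /eqP ->]; rewrite mulrC.
Qed.

Lemma fprob_fiber (U : finType) (h : Omega -> U) (A : pred Omega) (B : pred U) :
  fprob (fun v => A v && B (h v)) =
  \sum_(b | B b) fprob (fun v => A v && (h v == b)).
Proof.
rewrite /fprob (partition_big h B) /=; last by move=> v /andP[].
apply: eq_bigr => b Bb; apply: eq_bigl => v.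
by case: eqP => [->|]; rewrite ?Bb ?andbT ?andbF.
Qed.

(* For fixed [a], the signed weights [P(f1 = a, f2 = b) - P(f1 = a) P(f2 = b)]
   integrate [g] to at most [M] times their total positive part, which is the
   mixing defect on the single event that the weight at [f2] is positive. *)
Lemma fexp_decouple (U1 U2 : finType) (f1 : Omega -> U1) (f2 : Omega -> U2)
    (z : U1 -> R) (g : U2 -> R) (M phi : R) :
  (forall a (B : pred U2),
     fprob (fun v => (f1 v == a) && B (f2 v))
       - fprob (fun v => f1 v == a) * fprob (fun v => B (f2 v))
     <= phi * fprob (fun v => f1 v == a)) ->
  (forall a, 0 <= z a) -> (forall b, 0 <= g b <= M) -> 0 <= M ->
  fexp (fun v => z (f1 v) * g (f2 v)) <=
  fexp (fun v => z (f1 v)) * (fexp (fun v => g (f2 v)) + M * phi).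
Proof.
move=> mix z0 gM M0.
pose s a b := fprob (fun v => (f1 v == a) && (f2 v == b))
              - fprob (fun v => f1 v == a) * fprob (fun v => f2 v == b).
have Eg : fexp (fun v => g (f2 v)) = \sum_b g b * fprob (fun v => f2 v == b).
  exact: (fexp_fiber f2 xpredT g).
have key a : \sum_(v | f1 v == a) Q v * g (f2 v) <=
    fprob (fun v => f1 v == a) * (fexp (fun v => g (f2 v)) + M * phi).
  rewrite fexp_fiber mulrDr Eg -lerBlDl big_distrr -sumrB /=.
  pose pos b := 0 < s a b.
  apply: (@le_trans _ _ (\sum_(b | pos b) M * s a b)).
    rewrite [leRHS]big_mkcond /=; apply: ler_sum => b _.
    rewrite (_ : _ - _ = g b * s a b); last by rewrite /s; ring.
    have /andP[g0 gb] := gM b.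
    rewrite /pos; case: ltP => [s0|s0]; last by rewrite mulr_ge0_le0.
    by rewrite ler_wpM2r // ltW.
  have := mix a pos.
  rewrite (fprob_fiber f2 (fun v => f1 v == a)).
  rewrite (fprob_fiber f2 xpredT pos : fprob (fun v => pos (f2 v)) = _) /=.
  rewrite big_distrr -sumrB /= => /(ler_wpM2l M0).
  by rewrite -big_distrr /= => /le_trans; apply; rewrite mulrCA mulrC -mulrA mulrCA mulrA.
rewrite {1}/fexp (partition_big f1 xpredT) //=.
rewrite [X in _ <= X * _](_ : _ = \sum_a z a * fprob (fun v => f1 v == a)); last first.
  exact: (fexp_fiber f1 xpredT z).
rewrite big_distrl /=; apply: ler_sum => a _.
rewrite (eq_bigr (fun v => z a * (Q v * g (f2 v)))); last first.
  by move=> v /eqP ->; rewrite mulrCA.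
by rewrite -big_distrr -mulrA /=; apply: ler_wpM2l.
Qed.

Lemma fprob_markov (h : Omega -> R) (t : R) :
  fprob (fun v => t <= h v) * expR t <= fexp (fun v => expR (h v)).
Proof.
rewrite /fprob /fexp big_distrl /= big_mkcond /=; apply: ler_sum => v _.
case: ifPn => [th|_]; last by rewrite mulr_ge0 // expR_ge0.
by rewrite ler_wpM2l // ler_expR.
Qed.

Lemma fprob_sub (A B : pred Omega) : (forall v, A v -> B v) -> fprob A <= fprob B.
Proof.
move=> AB; rewrite /fprob [leLHS]big_mkcond [leRHS]big_mkcond /=.
apply: ler_sum => v _; case: ifPn => [/AB -> //|_]; by case: ifP.
Qed.

Lemma fprobU (A B : pred Omega) : fprob (fun v => A v || B v) <= fprob A + fprob B.
Proof.
rewrite /fprob (big_mkcond A) (big_mkcond B) /= [leLHS]big_mkcond -big_split /=.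
by apply: ler_sum => v _; move: (Q_ge0 v) => Qv; case: (A v); case: (B v) => /=; lra.
Qed.

End FiniteExpectation.

(** Multiply by [1 - x > 0]: the left side is at most [1] because [1 - x <= expR (- x)], and the
    right side becomes [1 + x^2 (1 - 2 x) >= 1]. *)
Lemma expR_le_quadratic {R : realType} (x : R) :
  x <= 1/2 -> expR x <= 1 + x + 2 * x ^+ 2.
Proof.
move=> xle.
have h : 1 - x <= expR (- x) by have := expR_ge1Dx (- x).
have e0 : 0 < expR x by exact: expR_gt0.
have h1 : (1 - x) * expR x <= 1.
  by rewrite -[leRHS](expRxMexpNx_1 x) mulrC; apply: ler_wpM2l h; exact: ltW.
rewrite -(@ler_pM2l _ (1 - x)); last lra.
apply: (le_trans h1); nra.
Qed.

(** * Exponential moments of block sums of mixing bits *)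

Section MixingBits.
Context {R : realType} {N : nat}.

(** Clearing the bits outside [J] keeps the tuple type, so a predicate of [bmask J v] encodes an
    event that depends on the bits in [J] alone. *)
Definition bmask (J : pred nat) (v : N.-tuple bool) : N.-tuple bool :=
  [tuple of mkseq (fun i => J i && nth false v i) N].

Lemma nth_bmask J v i : nth false (bmask J v) i = J i && nth false v i.
Proof.
case: (ltnP i N) => iN; first by rewrite nth_mkseq.
by rewrite !nth_default ?size_tuple ?andbF.
Qed.

Variables (Q : N.-tuple bool -> R) (phi : nat -> R) (q : R).

(* Coordinate [i] stands for [X_(i+1)]: the future starts at [X_(k+g)]. *)
Definition mixing_law := forall (k g : nat) (A B : pred (N.-tuple bool)),
  let A' v := A (bmask (fun i => i < k)%N v) in
  let B' v := B (bmask (fun i => k + g <= i.+1)%N v) in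
  `|fprob Q (fun v => A' v && B' v) - fprob Q A' * fprob Q B'| <=
  phi g * fprob Q A'.

Hypothesis Q_ge0 : forall v, 0 <= Q v.
Hypothesis Q_sum1 : \sum_v Q v = 1.
Hypothesis Q_mix : mixing_law.
Hypothesis q01 : 0 <= q <= 1.
Hypothesis Q_marg : forall i, (i < N)%N -> fprob Q (fun v => nth false v i) = q.

Definition cbit (i : nat) (v : N.-tuple bool) : R := (nth false v i)%:R - q.

Lemma cbit_norm i v : `|cbit i v| <= 1.
Proof. by rewrite /cbit ler_norml; move: q01; case: (nth _ _ _) => /=; lra. Qed.

Lemma fexp_cbit i : (i < N)%N -> fexp Q (cbit i) = 0.
Proof.
move=> iN; rewrite /cbit fexpD fexp_cst // (fexp_indic Q (fun v => nth false v i)).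
by rewrite Q_marg // subrr.
Qed.

Lemma fexp_cbit_mul i j : fexp Q (fun v => cbit i v * cbit j v) =
  fprob Q (fun v => nth false v i && nth false v j)
  - q * fprob Q (fun v => nth false v i)
  - q * fprob Q (fun v => nth false v j) + q ^+ 2.
Proof.
rewrite -!fexp_indic -!mulNr -!fexpZ -[in RHS](fexp_cst Q_sum1 (q ^+ 2)) -!fexpD.
apply: eq_fexp => v; rewrite /cbit.
by case: (nth _ _ i); case: (nth _ _ j) => /=; ring.
Qed.

(** Mixing is applied to the events that bits [i] and [j] are set. The bound is relative to the
    probability of the first event; the resulting factor [q] makes block variances proportional to
    [q]. *)
Lemma fexp_cbit_cov i j : (i < j)%N -> (j < N)%N ->
  `|fexp Q (fun v => cbit i v * cbit j v)| <= phi (j - i) * q.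
Proof.
move=> ij jN; have iN := ltn_trans ij jN.
rewrite fexp_cbit_mul !Q_marg //.
have := Q_mix i.+1 (j - i)%N (fun v => nth false v i) (fun v => nth false v j).
rewrite /=.
have -> : fprob Q (fun v => nth false (bmask (fun i0 => i0 < i.+1)%N v) i) = q.
  by rewrite -(Q_marg iN); apply: eq_bigl => v; rewrite nth_bmask ltnSn.
have -> : fprob Q (fun v => nth false (bmask (fun i0 => i.+1 + (j - i) <= i0.+1)%N v) j) = q.
  rewrite -(Q_marg jN); apply: eq_bigl => v; rewrite nth_bmask.
  by rewrite addSn ltnS subnKC ?leqnn // ltnW.
have -> : fprob Q (fun v => nth false (bmask (fun i0 => i0 < i.+1)%N v) i &&
    nth false (bmask (fun i0 => i.+1 + (j - i) <= i0.+1)%N v) j) =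
    fprob Q (fun v => nth false v i && nth false v j).
  apply: eq_bigl => v; rewrite !nth_bmask ltnSn.
  by rewrite addSn ltnS subnKC ?leqnn // ltnW.
by congr (`| _ | <= _); ring.
Qed.

Lemma fexp_cbit_sq i : (i < N)%N -> fexp Q (fun v => cbit i v * cbit i v) <= q.
Proof.
move=> iN; rewrite fexp_cbit_mul Q_marg //.
have -> : fprob Q (fun v => nth false v i && nth false v i) = q.
  by rewrite -(Q_marg iN); apply: eq_bigl => v; rewrite andbb.
by move: q01 => /andP[q0 _]; nra.
Qed.

Variables (c : nat -> R) (S : R).
Hypothesis c_le1 : forall i, `|c i| <= 1.
Hypothesis phi_sum : forall l, \sum_(0 <= i < l) phi (l - i) <= S.

(** The weights [c] will be a sign times the indicator of the blocks of one parity below [n], so one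
    estimate serves both signs and both parities. *)
Definition wsum (a b : nat) (v : N.-tuple bool) : R :=
  \sum_(a <= i < b) c i * cbit i v.

Lemma wsum_norm a b v : `|wsum a b v| <= (b - a)%:R.
Proof.
apply: (le_trans (ler_norm_sum _ _ _)).
rewrite -[leRHS]mulr_natr mul1r -sumr_const_nat; apply: ler_sum => i _.
by rewrite normrM mulr_ile1 // cbit_norm.
Qed.

Lemma fexp_wsum a b : (b <= N)%N -> fexp Q (wsum a b) = 0.
Proof.
move=> bN; rewrite /wsum fexp_sum big_nat big1 // => i /andP[_ ib].
by rewrite fexpZ fexp_cbit ?mulr0 // (leq_trans ib).
Qed.

(** By induction on the length: a new index adds its own variance, at most [q], and twice its
    covariances with the earlier indices, at most [2 * S * q] in all. *)
Lemma fexp_wsum_sq a l : (a + l <= N)%N ->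
  fexp Q (fun v => wsum a (a + l) v ^+ 2) <= l%:R * (q * (1 + 2 * S)).
Proof.
elim: l => [|l IH] alN.
  rewrite addn0 mul0r (@eq_fexp _ _ Q _ (fun=> 0)) ?fexp_cst // => v.
  by rewrite /wsum big_geq // expr0n.
have {IH} := IH (leq_trans (leq_add (leqnn a) (leqnSn l)) alN).
set n := (a + l)%N => IH.
have nN : (n < N)%N by rewrite /n -addnS.
rewrite addnS -/n.
rewrite (@eq_fexp _ _ Q _ (fun v => wsum a n v ^+ 2 +
   (2 * c n * (\sum_(a <= i < n) c i * (cbit i v * cbit n v)) +
    c n ^+ 2 * (cbit n v * cbit n v)))); last first.
  move=> v.
  have -> : \sum_(a <= i < n) c i * (cbit i v * cbit n v) = wsum a n v * cbit n v.
    by rewrite /wsum big_distrl; apply: eq_bigr => i _ /=; rewrite mulrA.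
  by rewrite {1}/wsum big_nat_recr ?leq_addr //= -/(wsum a n v); ring.
rewrite !fexpD !fexpZ fexp_sum.
have [q0 q1] := andP q01.
have cn2 : c n ^+ 2 <= 1.
  by rewrite -real_normK ?num_real // exprn_ile1.
have sq : c n ^+ 2 * fexp Q (fun v => cbit n v * cbit n v) <= q.
  apply: (le_trans _ (fexp_cbit_sq nN)); rewrite ler_piMl //.
  rewrite -(fexp_cst Q_sum1 0); apply: (le_fexp Q_ge0) => v; rewrite -expr2; exact: sqr_ge0.
have cr : 2 * c n * (\sum_(a <= i < n) fexp Q (fun v => c i * (cbit i v * cbit n v)))
    <= 2 * (S * q).
  rewrite -mulrA ler_pM2l //; apply: (le_trans (ler_norm _)); rewrite normrM.
  apply: (@le_trans _ _ (1 * (S * q))); last by rewrite mul1r.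
  apply: ler_pM => //; apply: (le_trans (ler_norm_sum _ _ _)).
  apply: (@le_trans _ _ (\sum_(a <= i < n) phi (n - i) * q)).
    rewrite big_nat [leRHS]big_nat; apply: ler_sum => i /andP[_ iN].
    rewrite fexpZ normrM.
    apply: (le_trans _ (fexp_cbit_cov iN nN)).
    by rewrite ler_piMl.
  rewrite -big_distrl /= ler_wpM2r //.
  have -> : \sum_(a <= i < n) phi (n - i) = \sum_(0 <= i < l) phi (l - i).
    rewrite -{1}[a]add0n big_addn {1}/n addKn; apply: eq_bigr => i _.
    by rewrite /n addnC subnDr.
  exact: phi_sum.
rewrite -natr1; lra.
Qed.

(** The condition on [lam * l] puts the exponent in the range of [expR_le_quadratic]; the linear
    term has mean zero, so only the second moment remains. *)
Lemma fexp_expR_wsum a l (lam : R) : (a + l <= N)%N -> 0 <= lam ->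
  lam * l%:R <= 1/2 ->
  fexp Q (fun v => expR (lam * wsum a (a + l) v)) <=
  1 + 2 * lam ^+ 2 * (l%:R * (q * (1 + 2 * S))).
Proof.
move=> alN lam0 laml.
apply: (@le_trans _ _ (fexp Q (fun v =>
   1 + (lam * wsum a (a + l) v + 2 * lam ^+ 2 * wsum a (a + l) v ^+ 2)))).
  apply: (le_fexp Q_ge0) => v.
  apply: (le_trans (expR_le_quadratic _)).
    apply: le_trans laml; apply: ler_wpM2l => //.
    by apply: (le_trans (ler_norm _)); rewrite -{2}(addKn a l) wsum_norm.
  by rewrite exprMn le_eqVlt; apply/orP; left; apply/eqP; ring.
rewrite !fexpD !fexpZ fexp_cst // fexp_wsum // mulr0 add0r lerD2l.
by apply: ler_wpM2l (fexp_wsum_sq alN); rewrite mulr_ge0 // sqr_ge0.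
Qed.

Hypothesis phi_ge0 : forall i, 0 <= phi i.
Hypothesis S_ge0 : 0 <= S.

Lemma wsum_bmask (J : pred nat) a b v :
  (forall i, (a <= i < b)%N -> J i) -> wsum a b (bmask J v) = wsum a b v.
Proof.
move=> Jab; rewrite /wsum big_nat [RHS]big_nat; apply: eq_bigr => i iab.
by rewrite /cbit nth_bmask Jab.
Qed.

(* Each new block is separated from the preceding nonzero one by a block of
   length [m] on which [c] vanishes. *)
Lemma fexp_expR_blocks (m : nat) (e : bool) (lam : R) : (0 < m)%N ->
  (forall i, odd (i %/ m) = e -> c i = 0) ->
  0 <= lam -> lam * m%:R <= 1/2 ->
  forall j, (j * m <= N)%N ->
  fexp Q (fun v => expR (lam * wsum 0 (j * m) v)) <=
  (1 + (2 * lam ^+ 2 * (m%:R * (q * (1 + 2 * S))) + 2 * phi m)) ^+ j.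
Proof.
move=> m0 c0 lam0 lamm; set x := (_ + 2 * phi m).
have [q0 q1] := andP q01.
have x0 : 2 * lam ^+ 2 * (m%:R * (q * (1 + 2 * S))) >= 0.
  by rewrite !mulr_ge0 ?sqr_ge0 // addr_ge0 // mulr_ge0.
have phim := phi_ge0 m.
have zero_block j v : odd j = e -> wsum (j * m) (j.+1 * m) v = 0.
  move=> oj; rewrite /wsum big_nat big1 // => i /andP[ji ij].
  rewrite c0 ?mul0r //; suff -> : (i %/ m = j)%N by [].
  by apply/eqP; rewrite eqn_leq leq_divRL // ji andbT -ltnS ltn_divLR.
have catw j v : wsum 0 (j.+1 * m) v = wsum 0 (j * m) v + wsum (j * m) (j.+1 * m) v.
  by rewrite /wsum (@big_cat_nat _ _ _ (j * m)) //= leq_mul2r leqnSn orbT.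
elim=> [|j IH] jN.
  rewrite mul0n expr0 (@eq_fexp _ _ Q _ (fun=> 1)) ?fexp_cst // => v.
  by rewrite /wsum big_geq // mulr0 expR0.
have jN' : (j * m <= N)%N by rewrite (leq_trans _ jN) // leq_mul2r leqnSn orbT.
have {}IH := IH jN'.
have p1 : 1 <= (1 + x) ^+ j by rewrite exprn_ege1 // /x; lra.
have [oj|oj] := boolP (odd j == e).
  rewrite (@eq_fexp _ _ Q _ (fun v => expR (lam * wsum 0 (j * m) v))); last first.
    by move=> v; rewrite catw zero_block ?addr0 //; apply/eqP.
  apply: (le_trans IH); rewrite exprSr ler_peMr //; first lra.
  by rewrite /x; lra.
have jb : (j.+1 * m = j * m + m)%N by rewrite mulSn addnC.
have blk : fexp Q (fun v => expR (lam * wsum (j * m) (j.+1 * m) v)) <=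
    1 + 2 * lam ^+ 2 * (m%:R * (q * (1 + 2 * S))).
  by rewrite jb; apply: fexp_expR_wsum => //; rewrite -jb.
(* The new block may be nonzero. If it is the first, there is nothing to decouple from; otherwise
   the block before it vanishes and serves as the gap. *)
case: j => [|j] in oj IH jN jN' p1 jb blk *.
  rewrite (@eq_fexp _ _ Q _ (fun v => expR (lam * wsum (0 * m) (1 * m) v))); last first.
    by move=> v; rewrite catw /wsum mul0n big_geq // add0r.
  by apply: (le_trans blk); rewrite expr1 /x; lra.
have {}oj : odd j = e by move: oj => /=; case: (odd j); case: (e).
have w0 v : wsum 0 (j.+1 * m) v = wsum 0 (j * m) v by rewrite catw zero_block ?addr0.
pose f1 := bmask (fun i => i < j * m)%N.
(* Because coordinates lag the variables by one, this mask starts one index before the new block; it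
   only has to contain that block. *)
pose f2 := bmask (fun i => j * m + m <= i.+1)%N.
pose z v := expR (lam * wsum 0 (j * m) v).
pose g v := expR (lam * wsum (j.+1 * m) (j.+2 * m) v).
have zf v : z (f1 v) = z v.
  by rewrite /z /f1 wsum_bmask // => i /andP[].
have gf v : g (f2 v) = g v.
  rewrite /g /f2 wsum_bmask // => i /andP[ji _].
  by rewrite -(addnC m) -mulSn (leq_trans ji).
(* The exponent is at most [1/2], and [expR (1/2) <= 1 + 1/2 + 1/2 = 2]: hence the factor [2] in
   front of [phi m]. *)
have gM v : 0 <= g v <= 2.
  rewrite /g expR_ge0 /=.
  have u : lam * wsum (j.+1 * m) (j.+2 * m) v <= 1/2.
    apply: le_trans lamm; apply: ler_wpM2l => //.
    apply: (le_trans (ler_norm _)); apply: (le_trans (wsum_norm _ _ _)).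
    by rewrite ler_nat -mulnBl subSnn mul1n.
  apply: (@le_trans _ _ (expR (1/2))); first by rewrite ler_expR.
  by apply: (le_trans (expR_le_quadratic _)) => //; lra.
have -> : fexp Q (fun v => expR (lam * wsum 0 (j.+2 * m) v)) =
    fexp Q (fun v => z (f1 v) * g (f2 v)).
  by apply: eq_fexp => v; rewrite zf gf /z /g -expRD -mulrDr -w0 -catw.
have dec : fexp Q (fun v => z (f1 v) * g (f2 v)) <=
    fexp Q (fun v => z (f1 v)) * (fexp Q (fun v => g (f2 v)) + 2 * phi m).
  apply: fexp_decouple => //; last by move=> a; exact: expR_ge0.
  move=> a B; have := Q_mix (j * m)%N m (fun v => v == a) B.
  by rewrite /= => /(le_trans (ler_norm _)).
apply: (le_trans dec); rewrite exprSr; apply: ler_pM.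
- by rewrite -(fexp_cst Q_sum1 0); apply: (le_fexp Q_ge0) => v; exact: expR_ge0.
- rewrite addr_ge0 //; last by rewrite mulr_ge0.
  by rewrite -(fexp_cst Q_sum1 0); apply: (le_fexp Q_ge0) => v; exact: expR_ge0.
- rewrite (@eq_fexp _ _ Q _ (fun v => expR (lam * wsum 0 (j.+1 * m) v))) // => v.
  by rewrite zf /z w0.
- rewrite /x addrA lerD2r.
  by rewrite (@eq_fexp _ _ Q _ (g)) // => v; rewrite gf.
Qed.

End MixingBits.

(** For one of the two signs, one parity of blocks must reach [t / 2]: four Chernoff bounds, hence
    the factor [4]. The tuple is padded to [J] full blocks, and the weights vanish from index [n]
    on. *)
Lemma mixing_tail {R : realType} (J m n : nat) (Q : (J * m).-tuple bool -> R)
    (phi : nat -> R) (q S lam t : R) :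
  (forall v, 0 <= Q v) -> \sum_v Q v = 1 -> mixing_law Q phi ->
  0 <= q <= 1 ->
  (forall i, (i < J * m)%N -> fprob Q (fun v => nth false v i) = q) ->
  (forall l, \sum_(0 <= i < l) phi (l - i)%N <= S) ->
  (forall i, 0 <= phi i) -> 0 <= S ->
  (0 < m)%N -> (n <= J * m)%N -> 0 <= lam -> lam * m%:R <= 1/2 ->
  fprob Q (fun v => t <= `|\sum_(0 <= i < n) cbit q i v|) <=
  4 * expR (- (lam * (t / 2)) + J%:R *
    (2 * lam ^+ 2 * (m%:R * (q * (1 + 2 * S))) + 2 * phi m)).
Proof.
move=> Q0 Q1 Qmix q01 Qmarg phiS phi0 S0 m0 nN lam0 lamm.
set x := (_ + 2 * phi m); set B := expR _.
have [q0 q1] := andP q01.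
pose c (s e : bool) i : R := (-1) ^+ s * ((i < n)%N && (odd (i %/ m) != e))%:R.
have one s e : fprob Q (fun v => t / 2 <= wsum q (c s e) 0 (J * m) v) <= B.
  have := fprob_markov Q0 (fun v => lam * wsum q (c s e) 0 (J * m) v) (lam * (t / 2)).
  have c1 i : `|c s e i| <= 1.
    by rewrite /c normrM normrX normrN1 expr1n mul1r; case: (_ && _); rewrite ?normr1 ?normr0.
  have c0 i : odd (i %/ m) = e -> c s e i = 0.
    by rewrite /c => ->; rewrite eqxx andbF mulr0.
  have := fexp_expR_blocks Q0 Q1 Qmix q01 Qmarg c1 phiS phi0 S0 m0 c0 lam0 lamm (leqnn _).
  rewrite -/x => h1 h2.
  have h3 : (1 + x) ^+ J <= expR (J%:R * x).
    rewrite expRM_natl lerXn2r ?nnegrE ?expR_ge0 ?expR_ge1Dx //.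
    by rewrite /x !addr_ge0 ?mulr_ge0 ?sqr_ge0 ?addr_ge0 ?mulr_ge0.
  have h4 := le_trans (le_trans h2 h1) h3.
  rewrite /B expRD expRN [leRHS]mulrC ler_pdivlMr ?expR_gt0 //.
  apply: le_trans h4; rewrite ler_wpM2r ?expR_ge0 //.
  by apply: fprob_sub => // v; apply: ler_wpM2l.
have half (s : bool) : fprob Q (fun v => t <= (-1) ^+ s * \sum_(0 <= i < n) cbit q i v) <= B + B.
  apply: le_trans (lerD (one s true) (one s false)).
  apply: le_trans (fprobU Q0 _ _); apply: fprob_sub => // v.
  have -> : (-1) ^+ s * \sum_(0 <= i < n) cbit q i v =
      wsum q (c s true) 0 (J * m) v + wsum q (c s false) 0 (J * m) v.
    rewrite /wsum -big_split /= [RHS](@big_cat_nat _ _ _ n) //= [X in _ = _ + X]big_nat.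
    rewrite [X in _ = _ + X]big1 ?addr0; last first.
      move=> i /andP[ni _]; rewrite /c ltnNge ni /= !mulr0 !mul0r addr0 //.
    rewrite big_distrr /= big_nat [RHS]big_nat; apply: eq_bigr => i /= iltn.
    by rewrite /c iltn; case: (odd _) => /=; ring.
  move=> tw; case: leP => //= w1; case: leP => //= w2; lra.
have -> : 4 * B = (B + B) + (B + B) by ring.
apply: le_trans (lerD (half true) (half false)).
apply: le_trans (fprobU Q0 _ _); apply: fprob_sub => // v.
by rewrite expr1 expr0 mulN1r mul1r ler_normr orbC.
Qed.

(** * The law of the indicators *)

Section RealProbability.
Context {d : measure_display} {T : measurableType d} {R : realType}.
Variable P : probability T R.

Lemma fine_prob_ge0 A : 0 <= fine (P A).
Proof. exact/fine_ge0/measure_ge0. Qed.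

Lemma fine_probK A : measurable A -> (fine (P A))%:E = P A.
Proof. by move=> mA; rewrite fineK // fin_num_measure. Qed.

Lemma fine_prob_le1 A : measurable A -> fine (P A) <= 1.
Proof. by move=> mA; rewrite -lee_fin fine_probK // probability_le1. Qed.

Lemma le_fine_prob A B : measurable A -> measurable B -> A `<=` B ->
  fine (P A) <= fine (P B).
Proof. by move=> mA mB AB; rewrite -lee_fin !fine_probK // le_measure ?inE. Qed.

Lemma phi_sigma_set_le1 (G H : set (set T)) :
  G `<=` measurable -> H `<=` measurable ->
  forall A B, G A -> H B -> (0 < P A)%E ->
  `|fine (P (A `&` B)) / fine (P A) - fine (P B)| <= 1.
Proof.
move=> Gm Hm A B /Gm mA /Hm mB PA.
have pA : 0 < fine (P A) by rewrite -lte_fin fine_probK.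
have b0 := fine_prob_ge0 B; have b1 := fine_prob_le1 mB.
have r0 : 0 <= fine (P (A `&` B)) / fine (P A).
  by rewrite divr_ge0 ?fine_prob_ge0.
have r1 : fine (P (A `&` B)) / fine (P A) <= 1.
  by rewrite ler_pdivrMr // mul1r le_fine_prob //; apply: measurableI.
by rewrite ler_norml; apply/andP; split; lra.
Qed.

(** A real [sup] is meaningful only for a nonempty bounded set: the pair [setT], [setT] contributes
    the member [0], and [phi_sigma_set_le1] gives the upper bound. *)
Lemma phi_sigma_bounds (G H : set (set T)) :
  G `<=` measurable -> H `<=` measurable -> G setT -> H setT ->
  0 <= phi_sigma P G H <= 1.
Proof.
move=> Gm Hm GT HT.
have zero : [set r : R | exists A B, G A /\ H B /\ (0 < P A)%E /\
    r = `|fine (P (A `&` B)) / fine (P A) - fine (P B)|] 0.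
  exists setT, setT; do !split => //; rewrite ?probability_setT //.
  by rewrite setIT probability_setT /= divr1 subrr normr0.
have ub : ubound [set r : R | exists A B, G A /\ H B /\ (0 < P A)%E /\
    r = `|fine (P (A `&` B)) / fine (P A) - fine (P B)|] 1.
  by move=> _ [A [B [GA [HB [PA ->]]]]]; exact: (phi_sigma_set_le1 Gm Hm).
apply/andP; split; first by apply: ub_le_sup zero; exists 1.
by apply: ge_sup ub; exists 0.
Qed.

(** The product form also covers a null event [A], for which both sides are zero. *)
Lemma phi_sigma_indep (G H : set (set T)) A B :
  G `<=` measurable -> H `<=` measurable -> G A -> H B ->
  `|fine (P (A `&` B)) - fine (P A) * fine (P B)| <= phi_sigma P G H * fine (P A).
Proof.
move=> Gm Hm GA HB; have mA := Gm _ GA; have mB := Hm _ HB.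
have := fine_prob_ge0 A; rewrite le_eqVlt => /predU1P[/esym A0|A0].
  have : fine (P (A `&` B)) <= fine (P A) by apply: le_fine_prob => //; apply: measurableI.
  have := fine_prob_ge0 (A `&` B).
  by rewrite A0 mulr0 mul0r subr0 normr_le0 => u w; apply/eqP; lra.
rewrite -ler_pdivrMr // -[X in _ / X]gtr0_norm // -normf_div.
rewrite mulrBl mulrAC divff ?gt_eqF // mul1r.
apply: ub_le_sup; first by exists 1 => _ [A' [B' [? [? [? ->]]]]]; exact: (phi_sigma_set_le1 Gm Hm).
by exists A, B; do !split => //; rewrite -fine_probK // lte_fin.
Qed.

End RealProbability.

(** Induction on [N], splitting on the last bit. The measurable type is arbitrary because the
    ambient sigma-algebra and those generated by some of the [X i] are both needed. *)
Lemma measurable_mkseq_bits {d : measure_display} {U : measurableType d}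
    (b : nat -> U -> bool) :
  (forall i, measurable [set w | b i w]) ->
  forall N (A : pred (seq bool)), measurable [set w | A (mkseq (b^~ w) N)].
Proof.
move=> mb; elim=> [|N IH] A.
  rewrite /=; case: (A [::]); first by rewrite (_ : [set _ | _] = setT) //; apply/seteqP; split.
  by rewrite (_ : [set _ | _] = set0) //; apply/seteqP; split.
rewrite (_ : [set _ | _] =
  ([set w | b N w] `&` [set w | A (rcons (mkseq (b^~ w) N) true)]) `|`
  (~` [set w | b N w] `&` [set w | A (rcons (mkseq (b^~ w) N) false)])).
  apply: measurableU; apply: measurableI.
  - exact: mb.
  - exact: (IH (fun s => A (rcons s true))).
  - exact/measurableC/mb.
  - exact: (IH (fun s => A (rcons s false))).
apply/seteqP; split => w /=; rewrite /mkseq -addn1 iotaD map_cat /= add0n cats1.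
  move=> h; have [bN|bN] := boolP (b N w); [left|right]; move: h;
    by rewrite ?bN ?(negbTE bN); split => //; exact/negP.
by case=> -[bN]; [rewrite bN|move/negP/negbTE: bN => ->].
Qed.

Lemma measurable_tuple_bits {d : measure_display} {U : measurableType d}
    (b : nat -> U -> bool) N (A : pred (N.-tuple bool)) :
  (forall i, measurable [set w | b i w]) ->
  measurable [set w | A [tuple of mkseq (b^~ w) N]].
Proof.
move=> mb.
have := measurable_mkseq_bits mb N (fun s => if insub s is Some v then A v else false).
congr measurable; apply/seteqP; split => w /=; by rewrite valK.
Qed.

Section BitLaw.
Context {d : measure_display} {T : measurableType d} {R : realType}.
Variables (P : probability T R) (X : nat -> {RV P >-> R}).
Variables (lo hi : R).

Let phi := phi_mix P (fun i => X i : T -> R).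
Let sig (I : set nat) := sigmaX (fun i => X i : T -> R) I.

Lemma sigmaX_measurable I : sig I `<=` measurable.
Proof.
apply: smallest_sub; first exact: sigma_algebra_measurable.
by move=> _ [i [_ [B [mB ->]]]]; rewrite -[X in measurable X]setTI; exact: measurable_funP.
Qed.

Lemma sigmaX_setT I : sig I setT.
Proof. by rewrite -setC0; apply: sigma_algebraC; exact: sigma_algebra0. Qed.

Lemma phi_sigmaX_bounds I1 I2 : 0 <= phi_sigma P (sig I1) (sig I2) <= 1.
Proof.
by apply: phi_sigma_bounds; [exact: sigmaX_measurable|exact: sigmaX_measurable
  |exact: sigmaX_setT|exact: sigmaX_setT].
Qed.

Lemma phi_mix_ub n : has_ubound [set r : R | exists k : nat, (1 <= k)%N /\
  r = phi_sigma P (sig [set i | (1 <= i <= k)%N]) (sig [set i | (k + n <= i)%N])].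
Proof.
exists 1 => _ [k [_ ->]].
by have /andP[] := phi_sigmaX_bounds [set i | (1 <= i <= k)%N] [set i | (k + n <= i)%N].
Qed.

Lemma phi_sigma_le_mix k n : (1 <= k)%N ->
  phi_sigma P (sig [set i | (1 <= i <= k)%N]) (sig [set i | (k + n <= i)%N]) <= phi n.
Proof. by move=> k1; apply: ub_le_sup; [exact: phi_mix_ub|exists k]. Qed.

Lemma phi_mix_ge0 n : 0 <= phi n.
Proof.
apply: le_trans (phi_sigma_le_mix n (leqnn 1)).
by have /andP[] := phi_sigmaX_bounds [set i | (1 <= i <= 1)%N] [set i | (1 + n <= i)%N].
Qed.

Lemma phi_mix_le1 n : phi n <= 1.
Proof.
apply: ge_sup; first by exists (phi_sigma P (sig [set i | (1 <= i <= 1)%N])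
  (sig [set i | (1 + n <= i)%N])), 1.
move=> _ [k [_ ->]].
by have /andP[] := phi_sigmaX_bounds [set i | (1 <= i <= k)%N] [set i | (k + n <= i)%N].
Qed.

Definition bitX (w : T) (i : nat) : bool := lo < X i.+1 w <= hi.
Definition patX N (w : T) : N.-tuple bool := [tuple of mkseq (bitX w) N].
Definition lawX N (v : N.-tuple bool) : R := fine (P [set w | patX N w = v]).

Lemma sigmaX_bit (I : set nat) i : I i.+1 -> sig I [set w | bitX w i].
Proof.
move=> Ii; apply: sub_sigma_algebra; exists i.+1; split => //.
exists `]lo, hi]%classic; split; first exact: measurable_itv.
by apply/seteqP; split => w /=; rewrite in_itv.
Qed.

Lemma measurable_bit i : measurable [set w | bitX w i].
Proof. by apply: (@sigmaX_measurable setT); exact: sigmaX_bit. Qed.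

Lemma measurable_pat N (A : pred (N.-tuple bool)) : measurable [set w | A (patX N w)].
Proof. exact: (measurable_tuple_bits (b := fun i w => bitX w i) A measurable_bit). Qed.

Lemma measurable_pat1 N v : measurable [set w | patX N w = v].
Proof.
have := measurable_pat (pred1 v); congr measurable.
by apply/seteqP; split => w /eqP.
Qed.

Lemma bmask_pat N (J : pred nat) w :
  bmask J (patX N w) = [tuple of mkseq (fun i => J i && bitX w i) N].
Proof.
apply/val_inj/eq_in_map => i; rewrite mem_iota add0n /= => iN.
by rewrite nth_mkseq.
Qed.

(** [U] is the same space equipped with the sigma-algebra of the [X i] with [I i]; a bit outside [J]
    is constantly false, hence measurable there. *)
Lemma sigmaX_pat N (J : pred nat) (I : set nat) (A : pred (N.-tuple bool)) :
  (forall i, J i -> I i.+1) -> sig I [set w | A (bmask J (patX N w))].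
Proof.
move=> JI.
pose U := g_sigma_algebraType [set A : set T | exists i, I i /\
  exists B : set R, measurable B /\ A = (fun i => X i : T -> R) i @^-1` B].
have mb i : measurable [set w : U | J i && bitX w i].
  have [Ji|_] := boolP (J i) => /=; first exact: (sigmaX_bit (JI _ Ji)).
  by rewrite [X in measurable X](_ : _ = set0); [exact: measurable0|apply/seteqP; split].
rewrite (_ : [set w | _] = [set w | A [tuple of mkseq (fun i => J i && bitX w i) N]]).
  exact: (measurable_tuple_bits A mb).
by apply/seteqP; split => w /=; rewrite bmask_pat.
Qed.

(** The bridge from [P] to the finite model: a pattern event is a finite disjoint union of atoms. *)
Lemma lawX_prob N (A : pred (N.-tuple bool)) :
  fine (P [set w | A (patX N w)]) = fprob (@lawX N) A.
Proof.
have -> : [set w | A (patX N w)] = \bigcup_(v in [set` A]) [set w | patX N w = v].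
  apply/seteqP; split => [w Aw|w [v Av /= ->] //].
  by exists (patX N w).
rewrite measure_fin_bigcup //; first last.
- by move=> v _; exact: measurable_pat1.
- by move=> v1 v2 _ _ [w [/= <- <-]].
rewrite -(bigfs _ (index_enum_uniq _)); last by move=> v _; rewrite mem_index_enum.
rewrite /fprob /lawX -sum_fine // => v _; apply: fin_num_measure.
exact: measurable_pat1.
Qed.

Lemma lawX_ge0 N v : 0 <= @lawX N v.
Proof. exact: fine_prob_ge0. Qed.

Lemma lawX_sum1 N : \sum_v @lawX N v = 1.
Proof.
have := lawX_prob (@predT (N.-tuple bool)).
rewrite /fprob => <-; rewrite (_ : [set _ | _] = setT) ?probability_setT //.
by apply/seteqP; split.
Qed.

Lemma lawX_mixing N : mixing_law (@lawX N) phi.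
Proof.
move=> k g A B /=.
rewrite -!lawX_prob.
(* [phi_mix] ranges over [k >= 1]. For [k = 0] the past is trivial: the masked event holds
   everywhere or nowhere, and the defect is zero. *)
case: k => [|k].
  set a := A (bmask (fun=> false) [tuple of nseq N false]).
  have E w : A (bmask (fun i => i < 0)%N (patX N w)) = a.
    by rewrite /a; congr (A _); apply/val_inj/eq_in_map.
  set SA := [set w | A _]; set SB := [set w | B _].
  rewrite (_ : [set w | _ && _] = SA `&` SB); last first.
    by apply/seteqP; split => w /=; [move/andP|case=> h1 h2; apply/andP].
  have [aT|aF] := boolP a.
    rewrite (_ : SA = setT); last by apply/seteqP; split => w //= _; rewrite /SA /= E.
    by rewrite setTI probability_setT mul1r subrr normr0 mulr_ge0 ?phi_mix_ge0.
  rewrite (_ : SA = set0); last first.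
    by apply/seteqP; split => w //= Aw; move: aF; rewrite -(E w) Aw.
  by rewrite set0I measure0 mul0r subrr normr0 mulr0.
rewrite (_ : [set w | _ && _] = [set w | A (bmask (fun i => i < k.+1)%N (patX N w))] `&`
   [set w | B (bmask (fun i => k.+1 + g <= i.+1)%N (patX N w))]); last first.
  by apply/seteqP; split => w /=; [move/andP|case=> h1 h2; apply/andP].
apply: (le_trans (phi_sigma_indep P (@sigmaX_measurable [set i | (1 <= i <= k.+1)%N])
  (@sigmaX_measurable [set i | (k.+1 + g <= i)%N]) _ _)).
- exact: sigmaX_pat.
- exact: sigmaX_pat.
- by rewrite ler_wpM2r ?fine_prob_ge0 // phi_sigma_le_mix.
Qed.

End BitLaw.

(** The sharper bound [2 * K * (1 - 1 / (l + 1))] passes through the induction, since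
    [1 / y^3 <= 2 / (y (y + 1))] for [y >= 1]. *)
Lemma sum_cubic_decay {R : realType} (phi : nat -> R) (K : R) : 0 <= K ->
  (forall k, (0 < k)%N -> phi k <= K / k%:R ^+ 3) ->
  forall l, \sum_(0 <= i < l) phi (l - i)%N <= 2 * K.
Proof.
move=> K0 phiK l.
suff : \sum_(0 <= i < l) phi (l - i)%N <= 2 * K * (1 - l.+1%:R^-1).
  by move=> h; apply: (le_trans h); rewrite ler_piMr ?mulr_ge0 // lerBlDr lerDl.
elim: l => [|l IH]; first by rewrite big_geq // invr1 subrr mulr0.
rewrite big_nat_recl // subn0 -lerBrDl.
under eq_bigr do rewrite subSS.
apply: (le_trans IH); rewrite lerBrDl.
apply: (@le_trans _ _ (K / l.+1%:R ^+ 3 + 2 * K * (1 - l.+1%:R^-1))).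
  by rewrite lerD2r phiK.
have y1 : (1 : R) <= l.+1%:R by rewrite ler1n.
rewrite -[l.+2]addn1 natrD; set y := l.+1%:R in y1 *.
rewrite -subr_ge0.
have -> : 2 * K * (1 - (y + 1)^-1) - (K / y ^+ 3 + 2 * K * (1 - y^-1)) =
    K * ((2 * y ^+ 2 - y - 1) / (y ^+ 3 * (y + 1))).
  by field; apply/andP; split; lra.
by rewrite mulr_ge0 // divr_ge0 ?mulr_ge0 ?exprn_ge0 //; nra.
Qed.

(** * Deviation of the number of observations in an interval *)

Section MixingDeviation.
Context {d : measure_display} {T : measurableType d} {R : realType}.
Variables (P : probability T R) (X : nat -> {RV P >-> R}) (F : R -> R).
Hypothesis XF : forall i, (1 <= i)%N -> forall x, (F x)%:E = P [set w | X i w <= x].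

Lemma measurable_le_RV i x : measurable [set w | X i w <= x].
Proof.
rewrite (_ : [set _ | _] = X i @^-1` `]-oo, x]%classic); last first.
  by apply/seteqP; split => w /=; rewrite in_itv.
by rewrite -[X in measurable X]setTI; exact: measurable_funP.
Qed.

Lemma cdf_homo x y : x <= y -> F x <= F y.
Proof.
move=> xy; rewrite -lee_fin !(@XF 1) // le_measure ?inE //; try exact: measurable_le_RV.
by move=> w /= /le_trans; apply.
Qed.

Lemma cdf_range x : 0 <= F x <= 1.
Proof.
rewrite -!lee_fin (@XF 1) // measure_ge0 probability_le1 //.
exact: measurable_le_RV.
Qed.

Lemma prob_bitX lo hi i : lo <= hi ->
  fine (P [set w | bitX X lo hi w i]) = F hi - F lo.
Proof.
move=> lohi; have mb := measurable_bit X lo hi i.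
apply: EFin_inj; rewrite fine_probK //.
have : P [set w | X i.+1 w <= hi] = 
    (P [set w | (X i.+1 w <= lo)%R] + P [set w | bitX X lo hi w i])%E.
  rewrite -measureU //; last 2 first.
  - exact: measurable_le_RV.
  - by apply/seteqP; split => w //= -[]; rewrite /bitX leNgt => /negbTE ->.
  congr (P _); apply/seteqP; split => w /=; rewrite /bitX.
    by case: leP => /= _ h; [left|right].
  by case=> [/le_trans|/andP[]]; first exact.
rewrite -!XF // -(fine_probK P mb) -EFinD => -[->].
by rewrite addrAC subrr add0r.
Qed.

(** Transfers [mixing_tail] to [P], with [S = 2 * K]; one block more than [n %/ m] makes the blocks
    cover all [n] indices. *)
Lemma prob_bit_sum_ge lo hi n m (lam t K : R) : lo <= hi -> 0 <= K ->
  (forall k, (0 < k)%N -> phi_mix P (fun i => X i : T -> R) k <= K / k%:R ^+ 3) ->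
  (0 < m)%N -> 0 <= lam -> lam * m%:R <= 1/2 ->
  forall q J, q = F hi - F lo -> J = (n %/ m).+1 ->
  fine (P [set w | t <= `|\sum_(0 <= i < n) ((bitX X lo hi w i)%:R - q)|]) <=
  4 * expR (- (lam * (t / 2)) + J%:R *
    (2 * lam ^+ 2 * (m%:R * (q * (1 + 2 * (2 * K)))) + 2 * (K / m%:R ^+ 3))).
Proof.
move=> lohi K0 phiK m0 lam0 lamm q J qE JE.
have nN : (n <= J * m)%N by rewrite ltnW // -ltn_divLR // JE ltnSn.
have q01 : 0 <= q <= 1.
  have := cdf_homo lohi; have := cdf_range lo; have := cdf_range hi.
  by rewrite qE => /andP[? ?] /andP[? ?] ?; apply/andP; split; lra.
rewrite (_ : [set w | _] = [set w |
    t <= `|\sum_(0 <= i < n) cbit q i (patX X lo hi (J * m) w)|]); last first.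
  suff E w : \sum_(0 <= i < n) ((bitX X lo hi w i)%:R - q) =
      \sum_(0 <= i < n) cbit q i (patX X lo hi (J * m) w).
    by apply/seteqP; split => w /=; rewrite E.
  rewrite big_nat [RHS]big_nat; apply: eq_bigr => i /= iltn.
  by rewrite /cbit nth_mkseq // (leq_trans iltn).
rewrite (lawX_prob X lo hi (fun v => t <= `|\sum_(0 <= i < n) cbit q i v|)).
apply: (@le_trans _ _ (4 * expR (- (lam * (t / 2)) + J%:R *
    (2 * lam ^+ 2 * (m%:R * (q * (1 + 2 * (2 * K)))) +
     2 * phi_mix P (fun i => X i : T -> R) m)))); last first.
  rewrite ler_pM2l // ler_expR lerD2l ler_wpM2l // lerD2l ler_pM2l //.
  exact: phiK.
apply: mixing_tail => //.
- exact: lawX_ge0.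
- exact: lawX_sum1.
- exact: lawX_mixing.
- move=> i iN; rewrite -(lawX_prob X lo hi (fun v => nth false v i)).
  rewrite qE -(prob_bitX i lohi); congr (fine (P _)).
  by apply/seteqP; split => w /=; rewrite nth_mkseq.
- exact: sum_cubic_decay.
- move=> i; exact: phi_mix_ge0.
- by rewrite mulr_ge0.
Qed.

(* Blocks of length [n^(1/4) / 2] balance the exponential parameter [n^(-1/4)]
   against the mixing error [n m^(-4)], which stays bounded. *)
Lemma prob_bit_sum_ge_log lo hi n (s L K : R) : lo <= hi -> 0 <= K ->
  (forall k, (0 < k)%N -> phi_mix P (fun i => X i : T -> R) k <= K / k%:R ^+ 3) ->
  4 <= s -> s ^+ 4 = n%:R -> 0 <= L ->
  forall q, q = F hi - F lo ->
  (1 + 4 * K) * (q * s ^+ 2) <= L ->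
  fine (P [set w | 16 * s * L <= `|\sum_(0 <= i < n) ((bitX X lo hi w i)%:R - q)|]) <=
  4 * expR (- (4 * L) + 1024 * K).
Proof.
move=> lohi K0 phiK s4 sn L0 q qE qL.
have s0 : 0 < s by lra.
have q0 : 0 <= q by rewrite qE subr_ge0 cdf_homo.
(* As [s >= 4], rounding down keeps [s / 4 <= m <= s / 2]. The upper bound limits the exponents, the
   lower one the mixing error. *)
pose m := Num.truncn (s / 2).
have mle : m%:R <= s / 2 by rewrite /m truncn_le; lra.
have mgt : s / 2 < m%:R + 1 by rewrite natr1 /m truncnS_gt; lra.
have m1 : 1 <= m%:R :> R.
  by rewrite ler1n -(ltr_nat R); lra.
have m0 : (0 < m)%N by rewrite -(ler1n R).
have ms : s / 4 <= m%:R by lra.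
have lam0 : 0 <= s^-1 by rewrite invr_ge0 ltW.
have lamm : s^-1 * m%:R <= 1/2.
  by rewrite mulrC ler_pdivrMr //; lra.
apply: (le_trans (prob_bit_sum_ge (16 * s * L) lohi K0 phiK m0 lam0 lamm qE (erefl (n %/ m).+1))).
rewrite ler_pM2l // ler_expR.
set J := (n %/ m).+1.
have Jm : J%:R * m%:R <= 2 * s ^+ 4.
  have h1 : (J * m <= n + m)%N by rewrite /J mulSn addnC leq_add2r leq_divM.
  have h2 : m%:R <= s ^+ 4 by apply: (@le_trans _ _ s); [lra|rewrite ler_eXnr //; lra].
  rewrite -natrM; apply: (@le_trans _ _ (n + m)%:R); first by rewrite ler_nat.
  by rewrite natrD -sn; lra.
have s2 : s^-1 ^+ 2 * s ^+ 4 = s ^+ 2 by field; lra.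
(* The threshold gains [8 * L] in the exponent; the variance costs at most [4 * L] ([A1]) and mixing
   a constant ([A2]), where [1024 = 2 * 2 * 4^4]. *)
have -> : - (s^-1 * (16 * s * L / 2)) = - (8 * L) by field; lra.
have A1 : J%:R * (2 * s^-1 ^+ 2 * (m%:R * (q * (1 + 2 * (2 * K))))) <= 4 * L.
  apply: (@le_trans _ _ (4 * ((1 + 4 * K) * (q * s ^+ 2)))); last by rewrite ler_pM2l.
  rewrite -s2.
  have -> : J%:R * (2 * s^-1 ^+ 2 * (m%:R * (q * (1 + 2 * (2 * K))))) =
     (J%:R * m%:R) * (2 * s^-1 ^+ 2 * (q * (1 + 4 * K))) by ring.
  have -> : 4 * ((1 + 4 * K) * (q * (s^-1 ^+ 2 * s ^+ 4))) =
     (2 * s ^+ 4) * (2 * s^-1 ^+ 2 * (q * (1 + 4 * K))) by ring.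
  by rewrite ler_wpM2r // !mulr_ge0 ?sqr_ge0 //; lra.
have A2 : J%:R * (2 * (K / m%:R ^+ 3)) <= 1024 * K.
  have -> : J%:R * (2 * (K / m%:R ^+ 3)) = 2 * K * ((J%:R * m%:R) / m%:R ^+ 4).
    by field; lra.
  have -> : 1024 * K = 2 * K * 512 by ring.
  rewrite ler_wpM2l ?mulr_ge0 // ler_pdivrMr ?exprn_gt0 //; last lra.
  apply: (le_trans Jm).
  have : (s / 4) ^+ 4 <= m%:R ^+ 4 by rewrite lerXn2r ?nnegrE //; lra.
  rewrite expr_div_n => h.
  have -> : 2 * s ^+ 4 = 512 * (s ^+ 4 / 4 ^+ 4) by field.
  by rewrite ler_pM2l.
by rewrite mulrDr; lra.
Qed.

End MixingDeviation.

(** * Quantile, density and grid *)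

Section LocalQuantile.
Context {d : measure_display} {T : measurableType d} {R : realType}.
Variables (P : probability T R) (Y : {RV P >-> R}) (F : R -> R).
Hypothesis YF : forall x, (F x)%:E = P [set w | Y w <= x].

Lemma cdf_RVE : cdf Y = fun x => (F x)%:E.
Proof.
by apply/funext => x; rewrite YF /cdf /distribution /pushforward /=; congr (P _).
Qed.

Lemma cdf_quantile_has_inf (p : R) : 0 < p < 1 -> has_inf [set x | p <= F x].
Proof.
move=> /andP[p0 p1].
have c1 : F x @[x --> +oo] --> (1 : R).
  by have := cvg_cdfy1 Y; rewrite cdf_RVE => /fine_cvg.
have c0 : F x @[x --> -oo] --> (0 : R).
  by have := cvg_cdfNy0 Y; rewrite cdf_RVE => /fine_cvg.
split.
  have n1 : \forall x \near +oo, p < F x by exact: (cvgr_gt 1 c1).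
  have [x /= px] := filter_ex n1.
  by exists x; exact: ltW.
have [M [_ hM]] : \forall x \near -oo, F x < p by exact: (cvgr_lt 0 c0).
exists M => x /= pF; rewrite leNgt; apply/negP => /hM /=.
by rewrite ltNge pF.
Qed.

(** The local Lipschitz bound excludes a jump across [p]: after a step [h] with [h * (M + 1)] at
    most the gap, [F] is still on the same side of [p], which contradicts the infimum. Taking
    [M + 1] avoids division by zero. *)
Lemma cdf_quantile (p e M : R) : 0 < p < 1 ->
  let xi := inf [set x | p <= F x] in
  0 < e -> 0 <= M ->
  (forall u v, xi - e <= u -> u <= v -> v <= xi + e -> F v - F u <= M * (v - u)) ->
  {homo F : x y / x <= y} -> F xi = p.
Proof.
move=> p01 xi e0 M0 lip Fhomo.
have hi := cdf_quantile_has_inf p01; have [_ lb] := hi.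
have M1 : 0 < M + 1 by lra.
apply/eqP; rewrite eq_le; apply/andP; split; rewrite leNgt; apply/negP => hlt.
  pose h := Num.min e ((F xi - p) / (M + 1)).
  have h0 : 0 < h by rewrite lt_min e0 divr_gt0 // subr_gt0.
  have he : h <= e by rewrite ge_min lexx.
  have hM : h * (M + 1) <= F xi - p by rewrite -ler_pdivlMr // ge_min lexx orbT.
  have : F xi - F (xi - h) <= M * (xi - (xi - h)) by apply: lip; lra.
  rewrite (_ : xi - (xi - h) = h); last ring.
  move=> hF.
  have : inf [set x | p <= F x] <= xi - h by apply: ge_inf => //=; nra.
  by rewrite -/xi; lra.
pose h := Num.min e ((p - F xi) / (M + 1)).
have h0 : 0 < h by rewrite lt_min e0 divr_gt0 // subr_gt0.
have he : h <= e by rewrite ge_min lexx.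
have hM : h * (M + 1) <= p - F xi by rewrite -ler_pdivlMr // ge_min lexx orbT.
have [y /= py yh] := inf_adherent h0 hi.
have : F (xi + h) - F xi <= M * (xi + h - xi) by apply: lip; lra.
rewrite (_ : xi + h - xi = h); last ring.
by have := Fhomo _ _ (ltW yh); rewrite -/xi; nra.
Qed.

End LocalQuantile.

Lemma density_increment_le {R : realType} (F f : R -> R) (D : set R) (u v M : R) :
  {within D, continuous f} -> (forall x, D x -> 0 < f x <= M) ->
  u <= v -> `[u, v] `<=` D ->
  ((F v - F u)%:E = \int[lebesgue_measure]_(x in `[u, v]) (f x)%:E)%E ->
  F v - F u <= M * (v - u).
Proof.
move=> cf fM uv uvD Fint; rewrite -lee_fin Fint.
have mf : measurable_fun `[u, v] f.
  apply: subspace_continuous_measurable_fun; first exact: measurable_itv.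
  exact: continuous_subspaceW cf.
have M0 : 0 <= M.
  have /fM/andP[f0 fle] : D u by apply: uvD; rewrite /= in_itv /= lexx.
  by apply: le_trans fle; exact: ltW.
apply: (@le_trans _ _ (\int[lebesgue_measure]_(x in `[u, v]) (cst M%:E x))%E).
  apply: ge0_le_integral => //.
  - by move=> x /uvD/fM/andP[f0 _]; rewrite lee_fin ltW.
  - exact/measurable_EFinP.
  - by move=> x /uvD/fM/andP[_]; rewrite lee_fin.
rewrite integral_cst //= lebesgue_measure_itv /= lte_fin.
case: ltP => [_|vu]; first by rewrite -EFinB -EFinM.
by rewrite mule0 lee_fin mulr_ge0 // subr_ge0.
Qed.

Lemma bracket_nat {R : realType} (u : nat -> R) (M : nat) (x : R) : (0 < M)%N ->
  u 0%N <= x <= u M -> exists2 j, (j < M)%N & u j <= x <= u j.+1.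
Proof.
elim: M => // M IH _ /andP[x0 xM].
have [xu|ux] := leP x (u M); last by exists M => //; rewrite ltW.
case: M => [|M] in IH xM xu *; first by exists 0%N => //; rewrite x0.
by have [|j jM jx] := IH isT; [rewrite x0|exists j => //; exact: ltnW].
Qed.

(** * Oscillation of the empirical process around the quantile *)

Section EmpiricalDeviation.
Context {d : measure_display} {T : measurableType d} {R : realType}.
Variables (P : probability T R) (X : nat -> {RV P >-> R}) (F : R -> R) (xi : R).
Hypothesis Fhomo : {homo F : x y / x <= y}.

Let Fn n w x := empF (fun i => X i : T -> R) n w x.

(** [F xi] stands in place of [p]; the theorem identifies them through [cdf_quantile]. *)
Definition edev (n : nat) (w : T) (x : R) : R := (Fn n w x - F x) - (Fn n w xi - F xi).

Lemma empF_homo n w : {homo Fn n w : x y / x <= y}.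
Proof.
move=> x y xy; rewrite /Fn /empF ler_wpM2l ?invr_ge0 //; apply: ler_sum => i _.
by rewrite ler_nat; case: (leP (X i w) x) => // /le_trans ->.
Qed.

(** Since [Fn] and [F] are monotone, the deviation between two points exceeds the bound at the
    endpoints by at most the increment of [F]. *)
Lemma edev_between n w u x v B e : u <= x -> x <= v ->
  `|edev n w u| <= B -> `|edev n w v| <= B -> F v - F u <= e ->
  `|edev n w x| <= B + e.
Proof.
move=> ux xv; have := empF_homo n w ux; have := empF_homo n w xv.
have := Fhomo ux; have := Fhomo xv; rewrite /edev => h1 h2 h3 h4.
rewrite !ler_norml => /andP[h5 h6] /andP[h7 h8] h9.
by apply/andP; split; lra.
Qed.

Definition dlo (x : R) := Num.min xi x.
Definition dhi (x : R) := Num.max xi x.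

(** Up to sign, [n] times the deviation is the centred count of observations between [xi] and [x];
    ordering the endpoints treats both sides of [xi] at once. *)
Lemma edev_bits n w x : (0 < n)%N ->
  `|edev n w x| * n%:R =
  `|\sum_(0 <= i < n) ((bitX X (dlo x) (dhi x) w i)%:R - (F (dhi x) - F (dlo x)))|.
Proof.
move=> n0; have nn : n%:R != 0 :> R by rewrite pnatr_eq0 -lt0n.
pose b (y : R) i : R := (X i.+1 w <= y)%R%:R.
have nFn y : Fn n w y * n%:R = \sum_(0 <= i < n) b y i.
  by rewrite /Fn /empF mulrAC mulVf // mul1r big_add1.
have key lo hi : lo <= hi -> \sum_(0 <= i < n) ((bitX X lo hi w i)%:R - (F hi - F lo)) =
    ((Fn n w hi - F hi) - (Fn n w lo - F lo)) * n%:R.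
  move=> lohi; rewrite sumrB sumr_const_nat subn0 -mulr_natr.
  have -> : \sum_(0 <= i < n) (bitX X lo hi w i)%:R =
      \sum_(0 <= i < n) b hi i - \sum_(0 <= i < n) b lo i :> R.
    rewrite -sumrB; apply: eq_bigr => i _; rewrite /bitX /b ltNge.
    case: (leP (X i.+1 w) lo) => [/le_trans->//|_] /=; first by rewrite subrr.
    by rewrite subr0.
  by rewrite -!nFn; ring.
rewrite /edev /dlo /dhi -[n%:R in LHS]ger0_norm // -normrM; case: (leP xi x) => xx.
  by rewrite key.
by rewrite key 1?ltW // -normrN; congr (`| _ |); ring.
Qed.

End EmpiricalDeviation.

(** * Rates and the Borel-Cantelli argument *)

Lemma powR_quarterX {R : realType} (y : R) (k : nat) :
  (y `^ (1/4)) ^+ k = y `^ (k%:R / 4).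
Proof. by rewrite -powR_mulrn ?powR_ge0 // -powRrM mul1r mulrC. Qed.

Lemma powR_quarterK {R : realType} (y : R) : 0 <= y -> (y `^ (1/4)) ^+ 4 = y.
Proof. by move=> y0; rewrite powR_quarterX divff ?powRr1. Qed.

Lemma powR_quarter_ge {R : realType} (y A : R) : 0 <= y -> 0 <= A ->
  A ^+ 4 <= y -> A <= y `^ (1/4).
Proof.
move=> y0 A0; rewrite -{1}(powR_quarterK y0) => Ay.
by rewrite -(@ler_pXn2r _ 4) // nnegrE ?powR_ge0.
Qed.

(** With [s = n^(1/4)] and [l = (ln n)^(1/4)], [a n * s^2] is eventually at most [2 * C0 * l^3], and
    [C] times this is at most [l^4 = ln n] once [l >= 2 * C * C0]. *)
Lemma near_rate {R : realType} (a : nat -> R) (C0 C e : R) :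
  0 < C0 -> 0 <= C -> 0 < e ->
  (fun n : nat => a n / (C0 * (n%:R `^ (- (1/2))) * (ln n%:R `^ (3/4))))
    @ \oo --> (1 : R) ->
  \forall n \near \oo, [/\ 0 < a n, a n <= e, 4 <= n%:R `^ (1/4) :> R,
    1 <= ln n%:R :> R & C * (a n * (n%:R `^ (1/4)) ^+ 2) <= ln n%:R].
Proof.
move=> C00 C_ge0 e0 ra.
have r0 : \forall n \near \oo, 0 < a n / (C0 * (n%:R `^ (- (1/2))) * (ln n%:R `^ (3/4))).
  exact: (cvgr_gt 1 ra).
have r2 : \forall n \near \oo, a n / (C0 * (n%:R `^ (- (1/2))) * (ln n%:R `^ (3/4))) <= 2.
  by apply: (cvgr_le 1 ra); lra.
(* These thresholds yield [L >= 1], [l >= 2 * C * C0] and [s >= 4 + 8 * C0 / e], respectively. *)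
have n1 := nbhs_infty_ger (expR 1 : R).
have n2 := nbhs_infty_ger (expR ((2 * C * C0) ^+ 4)).
have n3 := nbhs_infty_ger ((4 + 8 * C0 / e) ^+ 4).
near=> n.
have h0 : 0 < a n / (C0 * (n%:R `^ (- (1/2))) * (ln n%:R `^ (3/4))) by near: n.
have h2 : a n / (C0 * (n%:R `^ (- (1/2))) * (ln n%:R `^ (3/4))) <= 2 by near: n.
have y1 : expR 1 <= n%:R :> R by near: n.
have y2 : expR ((2 * C * C0) ^+ 4) <= n%:R by near: n.
have y3 : (4 + 8 * C0 / e) ^+ 4 <= n%:R by near: n.
set y := n%:R in h0 h2 y1 y2 y3 *; set s := y `^ (1/4); set L := ln y in h0 h2 *.
have y0 : 0 < y by apply: lt_le_trans y1; exact: expR_gt0.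
have L1 : 1 <= L by rewrite -(expRK 1) ler_ln ?posrE ?expR_gt0.
have L2 : (2 * C * C0) ^+ 4 <= L by rewrite -[leLHS]expRK ler_ln ?posrE ?expR_gt0.
have L0 : 0 < L by lra.
pose l := L `^ (1/4).
have l0 : 0 < l by exact: powR_gt0.
have lC : 2 * C * C0 <= l.
  by apply: powR_quarter_ge; [lra|rewrite !mulr_ge0 // ltW|].
have l4 : l ^+ 4 = L by rewrite powR_quarterK // ltW.
have s0 : 0 < s by exact: powR_gt0.
have e8 : 0 < 8 * C0 / e by rewrite divr_gt0 // mulr_gt0.
have sA : 4 + 8 * C0 / e <= s by apply: powR_quarter_ge; [exact: ltW|lra|].
have s4 : s ^+ 4 = y by rewrite powR_quarterK // ltW.
have Ls : L < 4 * s.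
  have := ln_sublinear s0; rewrite /s ln_powR -/L -/s; lra.
have yE : y `^ (- (1/2)) = (s ^+ 2)^-1.
  by rewrite powRN powR_quarterX; congr (_ `^ _)^-1; field.
have LE : L `^ (3/4) = l ^+ 3 by rewrite powR_quarterX.
rewrite yE LE in h0 h2.
have den : 0 < C0 * (s ^+ 2)^-1 * l ^+ 3 by rewrite !mulr_gt0 // ?invr_gt0 exprn_gt0.
have a0 : 0 < a n by move: h0; rewrite pmulr_lgt0 // invr_gt0.
rewrite ler_pdivrMr // in h2.
have l1 : 1 <= l by apply: powR_quarter_ge; rewrite ?expr1n // ltW.
have as2 : a n * s ^+ 2 <= 2 * C0 * l ^+ 3.
  have -> : 2 * C0 * l ^+ 3 = 2 * (C0 / s ^+ 2 * l ^+ 3) * s ^+ 2 by field; lra.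
  by rewrite ler_wpM2r // sqr_ge0.
split => //; last 2 first.
- by rewrite (le_trans _ sA) // lerDl ltW.
- apply: (le_trans (ler_wpM2l C_ge0 as2)).
  have -> : C * (2 * C0 * l ^+ 3) = (2 * C * C0) * l ^+ 3 by ring.
  by rewrite -l4 [leRHS]exprS ler_wpM2r // exprn_ge0 // ltW.
(* Trading the logarithm for one power of [s] gives [a n * s <= 8 * C0 <= e * s], hence
   [a n <= e]. *)
have l3 : l ^+ 3 <= 4 * s.
  by apply: ltW; apply: le_lt_trans Ls; rewrite -l4 ler_weXn2l.
have h3 : a n * s ^+ 2 <= 8 * C0 * s.
  apply: (le_trans as2); have -> : 8 * C0 * s = 2 * C0 * (4 * s) by ring.
  by rewrite ler_wpM2l // mulr_ge0 // ltW.
have h4 : a n * s <= 8 * C0.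
  by rewrite -(ler_pM2r s0) -mulrA -expr2.
have h5 : 8 * C0 <= e * s.
  by rewrite [leRHS]mulrC -ler_pdivrMr //; lra.
by rewrite -(ler_pM2r s0); lra.
Unshelve. all: by end_near.
Qed.

(** The bounds telescope, so the probabilities sum to at most [C] and the first Borel-Cantelli lemma
    applies. *)
Lemma negligible_lim_sup {d : measure_display} {T : measurableType d} {R : realType}
    (P : probability T R) (E : nat -> set T) (C : R) :
  (forall n, measurable (E n)) -> 0 <= C ->
  (forall n, fine (P (E n)) <= C * (n.+1%:R^-1 - n.+2%:R^-1)) ->
  P.-negligible (lim_sup_set E).
Proof.
move=> mE C0 PE.
have mL : measurable (lim_sup_set E).
  by apply: bigcapT_measurable => n; apply: bigcup_measurable.
apply/negligibleP => //; apply: lim_sup_set_cvg0 => //.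
apply: (@le_lt_trans _ _ C%:E); last exact: ltry.
apply: lime_le; first exact: is_cvg_nneseries.
apply: nearW => n.
rewrite (eq_bigr (fun i => (fine (P (E i)))%:E)); last by move=> i _; rewrite fine_probK.
rewrite sumEFin lee_fin.
apply: (@le_trans _ _ (C * (1 - n.+1%:R^-1))); last first.
  by rewrite ler_piMr // lerBlDr lerDl.
elim: n => [|n IH]; first by rewrite big_geq // invr1 subrr mulr0.
rewrite big_nat_recr //=; apply: (le_trans (lerD IH (PE n))).
by rewrite -mulrDr addrA subrK.
Qed.

Lemma fine_prob_bigsetU {d : measure_display} {T : measurableType d} {R : realType}
    (P : probability T R) (A : nat -> set T) n :
  (forall i, measurable (A i)) ->
  fine (P (\big[setU/set0]_(i < n) A i)) <= \sum_(i < n) fine (P (A i)).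
Proof.
move=> mA; rewrite -lee_fin fine_probK; last by apply: bigsetU_measurable.
rewrite -sumEFin (eq_bigr (fun i : 'I_n => P (A i))); last by move=> i _; rewrite fine_probK.
exact: Boole_inequality.
Qed.

Lemma limn_sum_sqrt_ge0 {R : realType} (u : nat -> R) :
  0 <= limn (fun m : nat => \sum_(1 <= k < m) Num.sqrt (u k)).
Proof.
have [cu|/dvgP ->] := pselect (cvgn (fun m : nat => \sum_(1 <= k < m) Num.sqrt (u k))).
  apply: limr_ge => //; apply: nearW => n; apply: sumr_ge0 => k _.
  exact: sqrtr_ge0.
by []. (* a divergent sequence has junk limit [point = 0] *)
Qed.

(** The indices [k < N] are absorbed into the constant: there [phi_mix] is at most
    [1 <= N^3 / k^3]. *)
Lemma phi_mix_cubic {d : measure_display} {T : measurableType d} {R : realType}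
    (P : probability T R) (X : nat -> {RV P >-> R}) :
  (exists K : R, exists N : nat, forall n : nat, (N <= n)%N ->
      phi_mix P (fun i => X i : T -> R) n <= K * (n%:R ^- 3)) ->
  exists2 K : R, 0 <= K &
    forall k, (0 < k)%N -> phi_mix P (fun i => X i : T -> R) k <= K / k%:R ^+ 3.
Proof.
move=> [K [N phiK]]; exists (`|K| + N%:R ^+ 3).
  by rewrite addr_ge0 // exprn_ge0.
move=> k k0; have k3 : 0 < k%:R ^+ 3 :> R by rewrite exprn_gt0 // ltr0n.
have [Nk|kN] := leqP N k.
  apply: (le_trans (phiK _ Nk)); apply: ler_wpM2r; first by rewrite invr_ge0 ltW.
  by apply: (le_trans (ler_norm K)); rewrite lerDl exprn_ge0.
apply: (le_trans (phi_mix_le1 X k)); rewrite ler_pdivlMr // mul1r.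
have : k%:R ^+ 3 <= N%:R ^+ 3 :> R.
  by rewrite lerXn2r ?nnegrE // ler_nat ltnW.
by move/le_trans; apply; rewrite lerDr.
Qed.

(** * Union bound over the grid at a fixed sample size *)

Section Oscillation.
Context {d : measure_display} {T : measurableType d} {R : realType}.
Variables (P : probability T R) (X : nat -> {RV P >-> R}) (F : R -> R).
Hypothesis XF : forall i, (1 <= i)%N -> forall x, (F x)%:E = P [set w | X i w <= x].
Variables (xi M : R) (K : R).
Hypothesis K0 : 0 <= K.
Hypothesis phiK : forall k, (0 < k)%N ->
  phi_mix P (fun i => X i : T -> R) k <= K / k%:R ^+ 3.

Definition grid (a : R) (n j : nat) : R := xi - a + j%:R * (a / n%:R).

Definition osc_event (n : nat) (t x : R) : set T :=
  [set w | t <= `|edev X F xi n w x| * n%:R].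

Lemma osc_eventE n t x : (0 < n)%N -> osc_event n t x =
  [set w | t <= `|\sum_(0 <= i < n) ((bitX X (dlo xi x) (dhi xi x) w i)%:R
                  - (F (dhi xi x) - F (dlo xi x)))|].
Proof. by move=> n0; apply/seteqP; split => w; rewrite /osc_event /= edev_bits. Qed.

Lemma measurable_osc_event n t x : (0 < n)%N -> measurable (osc_event n t x).
Proof.
move=> n0; rewrite osc_eventE //.
have := measurable_pat X (dlo xi x) (dhi xi x) (fun v : n.-tuple bool =>
  t <= `|\sum_(0 <= i < n) cbit (F (dhi xi x) - F (dlo xi x)) i v|).
congr measurable.
suff E w : \sum_(0 <= i < n) cbit (F (dhi xi x) - F (dlo xi x)) i
      (patX X (dlo xi x) (dhi xi x) n w) =
    \sum_(0 <= i < n) ((bitX X (dlo xi x) (dhi xi x) w i)%:R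
                  - (F (dhi xi x) - F (dlo xi x))).
  by apply/seteqP; split => w /=; rewrite E.
rewrite big_nat [RHS]big_nat; apply: eq_bigr => i /= iltn.
by rewrite /cbit nth_mkseq.
Qed.

Variables (n : nat) (a s L : R).
Hypothesis a0 : 0 < a.
Hypothesis s_ge4 : 4 <= s.
Hypothesis s_pow4 : s ^+ 4 = n%:R.
Hypothesis L_ge1 : 1 <= L.
Hypothesis M0 : 0 <= M.
Hypothesis lip : forall u v, xi - a <= u -> u <= v -> v <= xi + a ->
  F v - F u <= M * (v - u).
Hypothesis rate : (1 + 4 * K) * M * (a * s ^+ 2) <= L.

Let n_gt0 : (0 < n)%N.
Proof. by rewrite -(ltr0n R) -s_pow4; apply: exprn_gt0; move: s_ge4; lra. Qed.

Lemma gridS j : grid a n j.+1 = grid a n j + a / n%:R.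
Proof. by rewrite /grid -natr1; ring. Qed.

Lemma grid0 : grid a n 0 = xi - a.
Proof. by rewrite /grid mul0r addr0. Qed.

Lemma grid_last : grid a n (2 * n) = xi + a.
Proof.
have nn : n%:R != 0 :> R by rewrite pnatr_eq0 -lt0n.
by rewrite /grid natrM; field.
Qed.

Lemma grid_homo i j : (i <= j)%N -> grid a n i <= grid a n j.
Proof.
move=> ij; rewrite /grid lerD2l ler_wpM2r ?ler_nat //.
by rewrite divr_ge0 // ltW.
Qed.

Lemma grid_range j : (j <= 2 * n)%N -> xi - a <= grid a n j <= xi + a.
Proof. by move=> jn; rewrite -grid0 -grid_last !grid_homo. Qed.

(** A grid point is within [a] of [xi], so the interval has probability at most [M * a], and [rate]
    supplies the smallness condition of [prob_bit_sum_ge_log]. *)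
Lemma prob_osc_grid j : (j <= 2 * n)%N ->
  fine (P (osc_event n (16 * s * L) (grid a n j))) <= 4 * expR (- (4 * L) + 1024 * K).
Proof.
move=> jn; rewrite osc_eventE //; have /andP[g1 g2] := grid_range jn.
have dd : dlo xi (grid a n j) <= dhi xi (grid a n j).
  by rewrite /dlo /dhi le_max !ge_min lexx.
apply: (prob_bit_sum_ge_log XF) => //; first by move: L_ge1; lra.
apply: le_trans rate; rewrite -[leRHS]mulrA; apply: ler_wpM2l; first by move: K0; lra.
rewrite mulrA ler_wpM2r ?sqr_ge0 //.
apply: (@le_trans _ _ (M * (dhi xi (grid a n j) - dlo xi (grid a n j)))).
  by apply: lip => //; rewrite /dlo /dhi; case: (leP xi (grid a n j)) => ?; move: a0; lra.
by apply: ler_wpM2l => //; rewrite /dlo /dhi; case: (leP xi (grid a n j)) => ?; move: a0; lra.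
Qed.

Definition bad_event : set T :=
  \big[setU/set0]_(j < (2 * n).+1) osc_event n (16 * s * L) (grid a n j).

Lemma measurable_bad_event : measurable bad_event.
Proof. by apply: bigsetU_measurable => j _; exact: measurable_osc_event. Qed.

(** The union bound gives at most [12 / n^3] times [expR (1024 * K)], while the telescoping
    difference is [1 / ((n + 1) (n + 2)) >= 1 / (6 n^2)]; hence [72 = 12 * 6]. *)
Lemma prob_bad_event : expR L = n%:R ->
  fine (P bad_event) <= 72 * expR (1024 * K) * (n.+1%:R^-1 - n.+2%:R^-1).
Proof.
move=> Ln.
apply: (le_trans (fine_prob_bigsetU P (2 * n).+1 (A := fun j =>
  osc_event n (16 * s * L) (grid a n j)) _)).
  by move=> j; exact: measurable_osc_event.
apply: (@le_trans _ _ (\sum_(j < (2 * n).+1) (4 * expR (- (4 * L) + 1024 * K)))).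
  by apply: ler_sum => j _; apply: prob_osc_grid; rewrite -ltnS.
rewrite sumr_const card_ord -[leLHS]mulr_natl expRD expRN (expRM_natl 4 L) Ln.
have n1 : 1 <= n%:R :> R by rewrite ler1n.
have -> : (2 * n)%N.+1%:R = 2 * n%:R + 1 :> R by rewrite -natr1 natrM.
have -> : n.+2%:R = n%:R + 2 :> R by rewrite -addn2 natrD.
have -> : n.+1%:R = n%:R + 1 :> R by rewrite natr1.
set y := n%:R in n1 *.
have e0 : 0 <= expR (1024 * K) by exact: expR_ge0.
have -> : (2 * y + 1) * (4 * ((y ^+ 4)^-1 * expR (1024 * K))) =
  expR (1024 * K) * (4 * (2 * y + 1) / y ^+ 4) by field; lra.
have -> : 72 * expR (1024 * K) * ((y + 1)^-1 - (y + 2)^-1) =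
  expR (1024 * K) * (72 / ((y + 1) * (y + 2))) by field; apply/andP; split; lra.
apply: ler_wpM2l => //.
rewrite ler_pdivlMr; last by rewrite mulr_gt0; lra.
rewrite mulrAC ler_pdivrMr ?exprn_gt0 //; last lra.
have h1 : (y + 1) * (y + 2) <= 6 * y ^+ 2 by nra.
have h2 : 4 * (2 * y + 1) <= 12 * y by lra.
have h3 : y ^+ 3 <= y ^+ 4 by rewrite ler_weXn2l.
apply: (@le_trans _ _ (12 * y * (6 * y ^+ 2))).
  by apply: ler_pM => //; nra.
have -> : 12 * y * (6 * y ^+ 2) = 72 * y ^+ 3 by ring.
by rewrite ler_pM2l.
Qed.

Lemma osc_bound w x : a <= 1 -> ~ bad_event w -> xi - a <= x <= xi + a ->
  `|edev X F xi n w x| <= (M + 16) * (s ^+ 3)^-1 * L.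
Proof.
move=> a1 nbad xr; have s4 := s_ge4; have L1 := L_ge1.
have nn : 0 < n%:R :> R by rewrite ltr0n.
have s0 : 0 < s by lra.
have good j : (j <= 2 * n)%N -> `|edev X F xi n w (grid a n j)| <= 16 * (s ^+ 3)^-1 * L.
  move=> jn.
  have : ~ osc_event n (16 * s * L) (grid a n j) w.
    move=> oj; apply: nbad; rewrite /bad_event.
    rewrite -(@bigcup_mkord _ (2 * n).+1
      (fun j => osc_event n (16 * s * L) (grid a n j))).
    by exists j.
  rewrite /osc_event /= => /negP; rewrite -ltNge => /ltW h.
  have {}h : `|edev X F xi n w (grid a n j)| <= 16 * s * L / n%:R by rewrite ler_pdivlMr.
  apply: (le_trans h); rewrite -s_pow4.
  suff -> : 16 * s * L / s ^+ 4 = 16 * (s ^+ 3)^-1 * L by [].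
  by field; lra.
have n2 : (0 < 2 * n)%N by rewrite muln_gt0 n_gt0.
have gx : grid a n 0 <= x <= grid a n (2 * n) by rewrite grid0 grid_last.
have [j jn /andP[xj1 xj2]] := bracket_nat n2 gx.
(* The mesh is [a / n] with [n = s^4], and [a <= 1 <= s * L]. *)
have inc : F (grid a n j.+1) - F (grid a n j) <= M * (s ^+ 3)^-1 * L.
  have /andP[r1 r2] := grid_range (ltnW jn).
  have /andP[r3 r4] := grid_range jn.
  apply: (le_trans (lip r1 (grid_homo (leqnSn j)) r4)).
  rewrite gridS [grid a n j + _]addrC addrK -[leRHS]mulrA ler_wpM2l //.
  rewrite ler_pdivrMr // -s_pow4.
  have -> : (s ^+ 3)^-1 * L * s ^+ 4 = s * L by field; lra.
  by nra.
have := edev_between (cdf_homo XF) xj1 xj2 (good _ (ltnW jn)) (good _ jn) inc.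
by move/le_trans; apply; rewrite le_eqVlt; apply/orP; left; apply/eqP; ring.
Qed.

End Oscillation.

(** * The almost sure oscillation bound *)

Theorem theorem2p1 (d0 : measure_display) (T : measurableType d0) (R : realType)
  (P : probability T R) (X : nat -> {RV P >-> R}) (F : R -> R)
  (p : R) (Nbhd : set R) (f : R -> R) (C0 : R) (a : nat -> R) :
  (* common marginal distribution function F *)
  (forall i : nat, (1 <= i)%N -> forall x : R,
      (F x)%:E = P [set w | X i w <= x]) ->
  (* phi(n) = O(n^-3) *)
  (exists K : R, exists N : nat, forall n : nat, (N <= n)%N ->
      phi_mix P (fun i => X i : T -> R) n <= K * (n%:R ^- 3)) ->
  0 < p < 1 ->
  let xi := inf [set x : R | p <= F x] in
  (* F has a positive continuous density f on the neighbourhood Nbhd of xi *)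
  nbhs xi Nbhd ->
  {within Nbhd, continuous f} ->
  (forall x, Nbhd x -> 0 < f x) ->
  (forall u v : R, u <= v -> `[u, v] `<=` Nbhd ->
      ((F v - F u)%:E = \int[lebesgue_measure]_(x in `[u, v]) (f x)%:E)%E) ->
  has_ubound (f @` Nbhd) ->
  let dd := sup (f @` Nbhd) in
  0 < dd ->
  0 < C0 ->
  (fun n : nat => a n / (C0 * (n%:R `^ (- (1/2))) * (ln n%:R `^ (3/4))))
      @ \oo --> (1 : R) ->
  let C3 := 4 * (1 + 4 * limn (fun m : nat => \sum_(1 <= k < m) Num.sqrt (phi_mix P (fun i => X i : T -> R) k))) in
  let H := fun (n : nat) (w : T) =>
    sup [set r : R | exists x : R, xi - a n <= x <= xi + a n /\
         r = `| (empF (fun i => X i : T -> R) n w x - F x)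
                - (empF (fun i => X i : T -> R) n w xi - p) | ] in
  {ae P, forall w, \forall n \near \oo,
      H n w <= (dd + 4 * C3) * (n%:R `^ (- (3/4))) * ln n%:R}.
Proof.
move=> XF phiO p01 xi nbd cf fpos Fint fub dd dd0 C00 ra C3 H.
have [K K0 phiK] := phi_mix_cubic phiO.
have [e0 /= e0_gt0 ballN] := (iffLR (nbhs_ballP _ _)) nbd.
(* Half the radius fits a closed interval into the ball; the cap [1] later provides [a n <= 1]. *)
pose e := Num.min (e0 / 2) 1.
have e_gt0 : 0 < e by rewrite lt_min ltr01 divr_gt0.
have e_le1 : e <= 1 by rewrite ge_min lexx orbT.
have e_lt : e < e0 by rewrite gt_min ltr_pdivrMr // ltr_pMr // ltr1n.
have eN : `[xi - e, xi + e] `<=` Nbhd.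
  move=> x; rewrite /= in_itv /= => /andP[x1 x2]; apply: ballN.
  by rewrite -ball_normE /= ltr_norml; apply/andP; split; lra.
have fdd x : Nbhd x -> 0 < f x <= dd.
  by move=> Nx; rewrite fpos //=; apply: ub_le_sup => //; exists x.
have lip u v : xi - e <= u -> u <= v -> v <= xi + e -> F v - F u <= dd * (v - u).
  move=> eu uv ve.
  have uvN : `[u, v] `<=` Nbhd.
    move=> x; rewrite /= in_itv /= => /andP[ux xv]; apply: eN.
    by rewrite /= in_itv /=; apply/andP; split; lra.
  by apply: (density_increment_le cf fdd uv uvN); exact: Fint.
have Fhomo : {homo F : x y / x <= y} by move=> x y; exact: (cdf_homo XF).
have Fxi : F xi = p.
  exact: (cdf_quantile (XF 1%N isT) p01 e_gt0 (ltW dd0) lip Fhomo).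
have C3_ge4 : 4 <= C3.
  by rewrite /C3; have := limn_sum_sqrt_ge0 (phi_mix P (fun i => X i : T -> R)); lra.
have C_ge0 : 0 <= (1 + 4 * K) * dd by rewrite mulr_ge0; lra.
have [N0 _ good] := near_rate C00 C_ge0 e_gt0 ra.
pose s n : R := n%:R `^ (1/4).
(* The estimates hold from [N0] on; empty events before that make the summable bound valid for every
   [n]. *)
pose E n := if (n < N0)%N then set0 else
  bad_event X F xi n (a n) (s n) (ln n%:R).
have sP n : (s n) ^+ 4 = n%:R by rewrite powR_quarterK.
have lipa n : (N0 <= n)%N -> forall u v, xi - a n <= u -> u <= v -> v <= xi + a n ->
    F v - F u <= dd * (v - u).
  by move=> /good[_ ae _ _ _] u v h1 h2 h3; apply: lip => //; lra.
have n_gt0 n : (N0 <= n)%N -> 0 < n%:R :> R.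
  by move=> /good[_ _ s4 _ _]; rewrite -(sP n) exprn_gt0 // (lt_le_trans _ s4).
have mE n : measurable (E n).
  rewrite /E; case: ltnP => // /good[_ _ s4 _ _].
  by apply: measurable_bad_event s4 (sP n).
have PE n : fine (P (E n)) <= 72 * expR (1024 * K) * (n.+1%:R^-1 - n.+2%:R^-1).
  rewrite /E; case: ltnP => [_|Nn].
    by rewrite measure0 !mulr_ge0 ?expR_ge0 // subr_ge0 lef_pV2 ?posrE // ler_nat.
  have [an0 _ s4 L1 rt] := good _ Nn.
  apply: (prob_bad_event XF K0 phiK an0 s4 (sP n) L1 (ltW dd0) (lipa _ Nn) rt).
  by rewrite lnK // posrE n_gt0.
have := negligible_lim_sup mE _ PE.
rewrite mulr_ge0 ?expR_ge0 // => /(_ isT); apply: negligibleS => w /= nH.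
apply: contrapT => nlim; apply: nH.
have [N1 nE] : exists N1, forall n, (N1 <= n)%N -> ~ E n w.
  apply: contrapT => h; apply: nlim => N1 _; apply: contrapT => h1; apply: h.
  by exists N1 => n Nn En; apply: h1; exists n.
exists (maxn N0 N1) => // n /=; rewrite geq_max => /andP[Nn N1n].
have [an0 ae s4 L1 rt] := good _ Nn.
have := nE _ N1n; rewrite /E ltnNge Nn /= => nbad.
have a1 : a n <= 1 by exact: le_trans e_le1.
apply: ge_sup.
  by eexists; exists xi; split; [apply/andP; split; lra|reflexivity].
move=> _ [x [xr ->]]; rewrite -Fxi.
apply: (le_trans (osc_bound XF an0 s4 (sP n) L1 (ltW dd0) (lipa _ Nn) a1 nbad xr)).
have -> : n%:R `^ (- (3/4)) = (s n ^+ 3)^-1 by rewrite powRN powR_quarterX.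
have s0 : 0 <= (s n ^+ 3)^-1 by rewrite invr_ge0 exprn_ge0 // powR_ge0.
(* What remains is [dd + 16 <= dd + 4 * C3], up to the factor [n^(-3/4)]. *)
apply: ler_wpM2r; first lra.
apply: ler_wpM2r => //; lra.
Qed.
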